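(* Let $\beta\in\mathbb R^p$, $\sigma>0$, $n\ge1$, and $\lambda=\sqrt{2\log p/n}$. Let $s_0$ be the smallest integer such that $\sum_{i=1}^p\min(\beta_i^2,\lambda^2\sigma^2)\le s_0\lambda^2\sigma^2$, let $T_0\subseteq\{1,\dots,p\}$ denote the positions of the $s_0$ largest coefficients of $\beta$ in absolute value, and let $a_0=|S_L|$ where $S_L=\{j:|\beta_j|>\lambda\sigma\}$. Then for every $c'>1/2$, $$\bigl|\{j\in T_0^c:\ |\beta_j|\ge\sqrt{\log p/(c'n)}\;\sigma\}\bigr|\ \le\ (2c'-1)(s_0-a_0).$$
   Context: $T_0^c=\{1,\dots,p\}\setminus T_0$; $|A|$ denotes the cardinality of a set $A$; $p\ge2$. *)

(* Defs.v *)
From HB Require Import structures.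
From mathcomp Require Import all_boot all_order all_algebra.
From mathcomp Require Import reals exp.

Set Implicit Arguments.
Unset Strict Implicit.
Unset Printing Implicit Defensive.

Import Order.TTheory GRing.Theory Num.Theory.
Local Open Scope ring_scope.

Definition lambda (R : realType) (p n : nat) : R :=
  Num.sqrt (2 * ln p%:R / n%:R).

Definition is_least_int (P : int -> Prop) (s : int) : Prop :=
  P s /\ forall m : int, P m -> s <= m.

Definition is_s0 (R : realType) (p n : nat) (beta : 'cV[R]_p) (sigma : R)
    (s0 : int) : Prop :=
  is_least_int (fun s : int =>
    \sum_(i < p) Num.min (beta i 0 ^+ 2) (lambda R p n ^+ 2 * sigma ^+ 2)
      <= s%:~R * lambda R p n ^+ 2 * sigma ^+ 2) s0.

(* Ties in absolute value may be broken in any way, so T need not be unique. *)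
Definition is_largest_positions (R : realType) (p : nat) (beta : 'cV[R]_p)
    (s : int) (T : {set 'I_p}) : Prop :=
  #|T|%:Z = s /\
  forall i j : 'I_p, i \in T -> j \notin T -> `|beta j 0| <= `|beta i 0|.

Definition large_set (R : realType) (p n : nat) (beta : 'cV[R]_p) (sigma : R) :
    {set 'I_p} :=
  [set j | lambda R p n * sigma < `|beta j 0|].

(* Main.v *)
(** Put [M = lambda^2 sigma^2] and [q = 1/(2c') < 1], so that the threshold in
    the statement reads [q M <= beta_j^2].  The bound [|S_L| <= s_0] forces
    [S_L] to lie inside [T_0].  If some position outside [T_0] reaches the
    threshold, so do all positions of [T_0]; hence, in the sum defining [s_0],
    each position of [S_L] contributes [M], and each other position of [T_0]
    and each position counted on the left contributes at least [q M].  The sum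
    is at most [s_0 M]; dividing by [q M] gives the claim. *)
Require Import Defs.
From HB Require Import structures.
From mathcomp Require Import all_boot all_order all_algebra.
From mathcomp Require Import reals exp.
From mathcomp Require Import ring lra.

Set Implicit Arguments.
Unset Strict Implicit.
Unset Printing Implicit Defensive.

Import Order.TTheory GRing.Theory Num.Theory.
Local Open Scope ring_scope.

Lemma sumr_mem (R : pzSemiRingType) (I : finType) (A : {set I}) :
  \sum_i (i \in A)%:R = #|A|%:R :> R.
Proof.
rewrite -natr_sum -sum1_card [in RHS]big_mkcond /=.
by congr (_%:R); apply: eq_bigr => i _; case: (i \in A).
Qed.

(** Each index with [M < b i] contributes exactly [M] to the sum, and every other index a
    nonnegative amount. *)
Lemma card_gt_le_sum_min (R : realFieldType) (I : finType) (b : I -> R) (M : R) :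
  0 < M -> (forall i, 0 <= b i) ->
  M * #|[set i | M < b i]|%:R <= \sum_i Num.min (b i) M.
Proof.
move=> M_gt0 b_ge0; rewrite -sumr_mem mulr_sumr; apply: ler_sum => i _.
rewrite inE; case: ltP => [_|b_le]; first by rewrite mulr1.
by rewrite mulr0.
Qed.

(** If some [j] with [M < b j] lay outside [T], every element of [T] would exceed [M] too, and [j]
    would make the inclusion of [T] strict, against the cardinality bound. *)
Lemma gt_subset_largest (R : realFieldType) (I : finType) (b : I -> R) (M : R)
    (T : {set I}) :
  (forall i j, i \in T -> j \notin T -> b j <= b i) ->
  (#|[set i | (M < b i)%R]| <= #|T|)%N -> [set i | M < b i] \subset T.
Proof.
move=> T_top leST; apply/subsetP => j jS; apply/negPn/negP => jT.
have subTS : T \subset [set i | M < b i].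
  apply/subsetP => i iT; move: jS; rewrite !inE => /lt_le_trans; apply.
  exact: T_top.
have /proper_card : T \proper [set i | M < b i].
  by apply/properP; split=> //; exists j.
by rewrite ltnNge leST.
Qed.

(** Meant for [b] the squared coefficients and [q = 1/(2c')]: as [(1 - q)/q = 2c' - 1], the
    conclusion is then the desired bound multiplied by [q]. *)
Lemma card_outside_largest_le (R : realFieldType) (I : finType) (b : I -> R)
    (M q : R) (T : {set I}) :
  0 < M -> q < 1 -> (forall i, 0 <= b i) ->
  (forall i j, i \in T -> j \notin T -> b j <= b i) ->
  \sum_i Num.min (b i) M <= #|T|%:R * M ->
  q * #|[set j in ~: T | q * M <= b j]|%:R
    <= (1 - q) * (#|T|%:R - #|[set i | M < b i]|%:R).
Proof.
move=> M_gt0 q_lt1 b_ge0 T_top sum_le.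
set N := [set j in ~: T | _]; set S := [set i | _].
have leST : #|S|%:R <= #|T|%:R :> R.
  rewrite -(ler_pM2l M_gt0) [leRHS]mulrC.
  exact: le_trans (card_gt_le_sum_min M_gt0 b_ge0) sum_le.
(* For empty [N], [leST] makes the right side nonnegative. Otherwise a witness [k] lifts all of [T]
   to the threshold, through [T_top]. *)
have [->|[k]] := set_0Vmem N.
  by rewrite cards0 mulr0 mulr_ge0 // subr_ge0 // ltW.
rewrite !inE => /andP[kT qMk].
have /subsetP subST : S \subset T.
  by apply: gt_subset_largest => //; rewrite -(ler_nat R).
have qM_leM : q * M <= M by rewrite ger_pMl // ltW.
suff : M * #|S|%:R + q * M * (#|T|%:R - #|S|%:R + #|N|%:R)
    <= \sum_i Num.min (b i) M.
  move=> /le_trans /(_ sum_le) le_TM; rewrite -(ler_pM2l M_gt0); lra.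
(* Cardinalities become sums of indicators, so the inequality can be checked index by index. *)
rewrite -!(sumr_mem R) -sumrB -big_split /= !mulr_sumr -big_split /=.
apply: ler_sum => i _.
have -> : (i \in N) = (i \notin T) && (q * M <= b i) by rewrite !inE.
(* An index of [S] lies in [T], so only the term [M] survives on the left. *)
have [iS|iS] := boolP (i \in S).
  rewrite subST //= subrr addr0 mulr0 mulr1 addr0 le_min lexx andbT.
  by move: iS; rewrite inE => /ltW.
rewrite mulr0 add0r subr0; have [iT|iT] /= := boolP (i \in T).
  by rewrite addr0 mulr1 le_min qM_leM andbT (le_trans qMk) ?T_top.
rewrite add0r; have [qMi|_] := boolP (q * M <= b i).
  by rewrite mulr1 le_min qMi.
by rewrite mulr0 le_min b_ge0 ltW.
Qed.

Theorem proposition1p5 (R : realType) (p n : nat) (hp : (2 <= p)%N)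
    (hn : (1 <= n)%N) (beta : 'cV[R]_p) (sigma : R) (hsigma : 0 < sigma)
    (s0 : int) (hs0 : is_s0 n beta sigma s0)
    (T0 : {set 'I_p}) (hT0 : is_largest_positions beta s0 T0)
    (a0 : nat) (ha0 : a0 = #|large_set n beta sigma|)
    (c' : R) (hc' : 1 / 2 < c') :
  #|[set j in ~: T0 |
      Num.sqrt (ln p%:R / (c' * n%:R)) * sigma <= `|beta j 0|]|%:R
    <= (2 * c' - 1) * (s0%:~R - a0%:R).
Proof.
have [[sum_le _] [cardT T_top]] := (hs0, hT0).
have c_gt0 : 0 < c' by lra.
have n_gt0 : 0 < n%:R :> R by rewrite ltr0n.
have lnp_gt0 : 0 < ln p%:R :> R by rewrite ln_gt0 // ltr1n.
have lam_gt0 : 0 < lambda R p n by rewrite sqrtr_gt0 divr_gt0 ?mulr_gt0.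
pose M := (lambda R p n * sigma) ^+ 2.
pose q := (2 * c')^-1.
have M_gt0 : 0 < M by rewrite exprn_gt0 ?mulr_gt0.
have q_lt1 : q < 1 by rewrite invf_lt1; lra.
have ler_abs (x y : R) : 0 <= x -> (x <= `|y|) = (x ^+ 2 <= y ^+ 2).
  by move=> x0; rewrite -(real_normK (num_real y)) ler_sqr ?nnegrE.
(* The 2 in the square of [lambda] cancels the one in [q], leaving [log p / (c' n)]. *)
have qME : q * M = (Num.sqrt (ln p%:R / (c' * n%:R)) * sigma) ^+ 2.
  rewrite /q /M /lambda !exprMn !sqr_sqrtr.
  - by field; rewrite !gt_eqF.
  - by rewrite ltW // divr_gt0 ?mulr_gt0.
  - by rewrite ltW // divr_gt0 ?mulr_gt0.
have := @card_outside_largest_le R _ (fun i => beta i 0 ^+ 2) M q T0 M_gt0 q_lt1.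
have -> : [set i | M < beta i 0 ^+ 2] = large_set n beta sigma.
  apply/setP => i; rewrite !inE /M -(real_normK (num_real (beta i 0))).
  by rewrite ltr_sqr ?nnegrE ?normr_ge0 ?mulr_ge0 ?ltW.
have -> : [set j in ~: T0 | q * M <= beta j 0 ^+ 2] = [set j in ~: T0 |
      Num.sqrt (ln p%:R / (c' * n%:R)) * sigma <= `|beta j 0|].
  apply/setP => i; rewrite !inE qME -ler_abs //.
  by rewrite mulr_ge0 ?sqrtr_ge0 ?ltW.
rewrite -ha0 -cardT => main.
have q_gt0 : 0 < q by rewrite invr_gt0 mulr_gt0.
rewrite -(ler_pM2l q_gt0).
have -> : q * ((2 * c' - 1) * (#|T0|%:~R - a0%:R)) =
    (1 - q) * (#|T0|%:R - a0%:R).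
  by rewrite /q -pmulrn; field; rewrite gt_eqF.
apply: main.
- by move=> i; rewrite sqr_ge0.
- move=> i j iT jT; rewrite -(real_normK (num_real (beta j 0))).
  by rewrite -ler_abs ?T_top.
- by move: sum_le; rewrite -cardT -pmulrn -mulrA -exprMn.
Qed.
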